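(* Let $J\subset\mathbb R$ be an interval, let $a_{ij}\colon J\to\mathbb R$ ($1\leq i\leq j\leq n$) and $f_i\colon J\to\mathbb R$ ($1\leq i\leq n$) be continuous functions, and consider the triangular system $$\frac{dx_i}{dt}=\sum_{j=i}^{n}a_{ij}(t)x_j+f_i(t),\quad i=1,\dots,n.$$ Fix $t_0\in J$ and put, for $t\in J$ and $\tau=1,\dots,n$, $$\varphi_\tau(t)=\exp\Bigl(-\int_{t_0}^{t}a_{\tau\tau}(\zeta)\,d\zeta\Bigr),\qquad\psi_\tau(t)=\exp\int_{t_0}^{t}a_{\tau\tau}(\zeta)\,d\zeta.$$ Define recursively, for $t\in J$, $A_{\zeta\zeta}(t)=1$ for $\zeta=1,\dots,n-1$, $$A_{\tau\xi}(t)=\int_{t_0}^{t}\Bigl(\sum_{k=1}^{\tau-\xi}a_{n+1-\tau,\,n+1+k-\tau}(\zeta)\,\psi_{n+1+k-\tau}(\zeta)\,A_{\tau-k,\,\xi}(\zeta)\Bigr)\varphi_{n+1-\tau}(\zeta)\,d\zeta,\quad\xi=1,\dots,\tau-1,\ \tau=1,\dots,n,$$ $$B_\tau(t)=\int_{t_0}^{t}\Bigl(f_{n+1-\tau}(\zeta)+\sum_{\xi=1}^{\tau-1}a_{n+1-\tau,\,n+1-\tau+\xi}(\zeta)\,\psi_{n+1-\tau+\xi}(\zeta)\,B_{\tau-\xi}(\zeta)\Bigr)\varphi_{n+1-\tau}(\zeta)\,d\zeta,\quad\tau=1,\dots,n.$$ Then the functions defined recursively by $$F_\tau(t,x)=x_{n+1-\tau}\,\varphi_{n+1-\tau}(t)-\sum_{\xi=1}^{\tau-1}A_{\tau\xi}(t)\,F_\xi(t,x)-B_\tau(t)\quad\text{for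 all }(t,x)\in J\times\mathbb R^n,\quad\tau=1,\dots,n,$$ are first integrals of the triangular system.
   Context: A first integral of $dx/dt=X(t,x)$ on a domain $G'$ (open arcwise connected set) is a continuously differentiable function $F\colon G'\to\mathbb R$ with $\partial_tF(t,x)+\sum_{i=1}^nX_i(t,x)\,\partial_{x_i}F(t,x)=0$ for all $(t,x)\in G'$. Empty sums are zero. *)

(* Defs.v *)
From HB Require Import structures.
From mathcomp Require Import all_boot all_order all_algebra.
From mathcomp Require Import all_classical all_reals all_analysis.

Set Implicit Arguments.
Unset Strict Implicit.
Unset Printing Implicit Defensive.

Import Order.TTheory GRing.Theory Num.Theory.
Import numFieldNormedType.Exports.

Local Open Scope classical_set_scope.
Local Open Scope ring_scope.

Section FirstIntegrals.
Context {R : realType}.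

(* Integral from s to t with the usual sign convention when t < s. *)
Definition oint (s t : R) (g : R -> R) : R :=
  if s <= t then \int[lebesgue_measure]_(z in `[s, t]) g z
  else - \int[lebesgue_measure]_(z in `[t, s]) g z.

Definition arcwise_connected (T : topologicalType) (G : set T) : Prop :=
  forall p q, G p -> G q ->
    exists g : R -> T,
      [/\ {within `[0, 1], continuous g}, g 0 = p, g 1 = q
        & g @` `[0, 1] `<=` G].

Definition domain (T : topologicalType) (G : set T) : Prop :=
  open G /\ arcwise_connected G.

Definition dt (n : nat) : R * 'rV[R]_n := (1, 0).
Definition dx (n : nat) (i : 'I_n) : R * 'rV[R]_n := (0, delta_mx 0 i).

Definition continuously_differentiable (n : nat)
    (G : set (R * 'rV[R]_n)) (F : R * 'rV[R]_n -> R) : Prop :=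
  [/\ forall p, G p -> differentiable F p,
      {within G, continuous (fun p => 'D_(dt n) F p)}
    & forall i : 'I_n, {within G, continuous (fun p => 'D_(dx i) F p)}].

(* Only the values of F on the open set G matter. *)
Definition first_integral (n : nat) (X : R -> 'rV[R]_n -> 'rV[R]_n)
    (G : set (R * 'rV[R]_n)) (F : R * 'rV[R]_n -> R) : Prop :=
  [/\ domain G, continuously_differentiable G F
    & forall t x, G (t, x) ->
        'D_(dt n) F (t, x)
        + \sum_(i < n) X t x 0 i * 'D_(dx i) F (t, x) = 0].

(* Coordinates are numbered from 1 to n: [xc x j] is the j-th coordinate of x
   for 1 <= j <= n.  Its value for other j is irrelevant. *)
Definition xc (n : nat) (x : 'rV[R]_n) (j : nat) : R :=
  oapp (fun i : 'I_n => x 0 i) 0 (insub j.-1).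

(* The coefficients carry indices 1, ..., n, so the entry of the row vector at
   the ordinal i is the right-hand side of equation number i.+1. *)
Definition triangular_field (n : nat) (a : nat -> nat -> R -> R)
    (f : nat -> R -> R) (t : R) (x : 'rV[R]_n) : 'rV[R]_n :=
  \row_(i < n) (\sum_(i.+1 <= j < n.+1) a i.+1 j t * xc x j + f i.+1 t).

Definition phi (a : nat -> nat -> R -> R) (t0 : R) (tau : nat) (t : R) : R :=
  expR (- oint t0 t (a tau tau)).

Definition psi (a : nat -> nat -> R -> R) (t0 : R) (tau : nat) (t : R) : R :=
  expR (oint t0 t (a tau tau)).

End FirstIntegrals.

(* Main.v *)
(** Fix a point [(t, x)] of [G], put [m = n + 1 - tau] and differentiate [F tau]
    along [(1, X t x)].  By induction the [F xi] with [xi < tau] have derivative 0,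
    and the contributions [+/- a_mm x_m phi_m] of [x_m'] and [phi_m'] cancel, which
    leaves
      phi_m (sum_(k >= 1) a_(m,m+k) x_(m+k) + f_m)
        - sum_(xi < tau) A_(tau,xi)' F_xi - B_tau'.
    The definition of [F (tau - k)] solves for [x_(m+k)]:
      x_(m+k) = psi_(m+k) (sum_(xi <= tau - k) A_(tau-k,xi) F_xi + B_(tau-k)).
    Substituting this and exchanging the two sums turns the first term into the
    integrands defining [A tau xi] and [B tau].  Since [G] is open, its points have
    their time in the interior of [J], where the fundamental theorem of calculus
    applies to these integrals. *)
Require Import Defs.
From HB Require Import structures.
From mathcomp Require Import all_boot all_order all_algebra.
From mathcomp Require Import all_classical all_reals all_analysis.
From mathcomp Require Import zify ring.

Set Implicit Arguments.
Unset Strict Implicit.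
Unset Printing Implicit Defensive.

Import Order.TTheory GRing.Theory Num.Theory.
Import numFieldNormedType.Exports.

Local Open Scope classical_set_scope.
Local Open Scope ring_scope.

(** * Differentiability under local equality, and derivatives of finite sums *)

Lemma near_eq_differentiable (R : numFieldType) (V W : normedModType R)
    (f g : V -> W) (x : V) :
  (\near x, f x = g x) -> differentiable f x -> differentiable g x.
Proof.
move=> fg /diff_locallyP [dfc df].
(* The differential of [f] also gives a first-order expansion of [g]; by uniqueness it is the
   differential of [g]. *)
have dg : g \o shift x = cst (g x) + 'd f x +o_ 0 id.
  apply: eqaddoE; apply/eqaddoP => e e0.
  have /eqaddoP/(_ e e0) := df.
  apply: filter_app.
  have : \forall h \near 0, f (h + x) = g (h + x).
    by move: fg; rewrite (near_shift 0) subr0.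
  by apply: filterS => h fgh; rewrite !fctE /= -fgh -(nbhs_singleton fg).
have dgE := diff_unique dfc dg.
by apply/diff_locallyP; rewrite dgE.
Qed.

Lemma is_derive_bigsum (R : numFieldType) (V W : normedModType R) (I : eqType)
    (r : seq I) (h : I -> V -> W) (dh : I -> W) (x v : V) :
  (forall i, i \in r -> is_derive x v (h i) (dh i)) ->
  is_derive x v (fun p => \sum_(i <- r) h i p) (\sum_(i <- r) dh i).
Proof.
elim: r => [_|i r IH hr].
  under eq_fun do rewrite big_nil.
  by rewrite big_nil; exact: is_derive_cst.
under eq_fun do rewrite big_cons.
rewrite big_cons; apply: is_deriveD; first exact/hr/mem_head.
by apply: IH => j jr; apply: hr; rewrite in_cons jr orbT.
Qed.

(** * The fundamental theorem of calculus for oriented integrals on an interval *)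

Section oint.
Context {R : realType}.
Notation mu := (@lebesgue_measure R).
Implicit Types (g h : R -> R) (J : set R).

Lemma eq_oint g h (s t : R) :
  (forall z, (s <= z <= t) || (t <= z <= s) -> g z = h z) ->
  oint s t g = oint s t h.
Proof.
move=> gh; rewrite /oint; case: ifP => _; [|congr (- _)];
  by apply: eq_Rintegral => z; rewrite inE/= in_itv/= => zst; apply: gh;
  rewrite zst ?orbT.
Qed.

(** A base point [c] to the left of both ends lets one formula serve both orientations. *)
Lemma ointE h (c s t : R) : continuous h -> c <= s -> c <= t ->
  oint s t h = \int[mu]_(z in `[c, t]) h z - \int[mu]_(z in `[c, s]) h z.
Proof.
move=> ch cs ct.
have ih a b : mu.-integrable `[a, b] (EFin \o h).
  apply: continuous_compact_integrable; first exact: segment_compact.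
  exact: continuous_subspaceT.
have main x y : c <= x -> x <= y -> \int[mu]_(z in `[x, y]) h z =
    \int[mu]_(z in `[c, y]) h z - \int[mu]_(z in `[c, x]) h z.
  move=> cx xy; rewrite Rintegral_itvB ?bnd_simp//.
  rewrite Rintegral_itv_obnd_cbnd//.
  by apply: integrableS (ih x y) => //; apply: subset_itvr; rewrite bnd_simp.
rewrite /oint; case: (leP s t) => st; first exact: main.
by rewrite main ?opprB// ltW.
Qed.

Lemma is_derive_oint h (t0 t : R) : continuous h ->
  is_derive t 1 (fun s => oint t0 s h) (h t).
Proof.
(* Subtracting 1 puts [c] strictly below [t], so that [t] is interior to [[c, t + 1]]. Replacing the
   base point [c] by [t0] then costs only the constant [I t0]. *)
move=> ch; pose c := Num.min t0 t - 1.
have ct0 : c <= t0 by rewrite lerBlDr ler_wpDr// ge_min lexx.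
have ct : c < t by rewrite ltrBlDr ltr_pwDr// ge_min lexx orbT.
have [] := @continuous_FTC1_closed R h c t (t + 1) _ _ ct (ch t).
- by rewrite ltrDl.
- apply: continuous_compact_integrable; first exact: segment_compact.
  exact: continuous_subspaceT.
set I := (fun x => _) => dI I't.
have eqI : \forall s \near t, I s - cst (I t0) s = oint t0 s h.
  near=> s; rewrite (ointE ch ct0)//.
  by apply: ltW; near: s; exact: lt_nbhsr.
apply: (near_eq_is_derive eqI).
rewrite -[h t]subr0; apply: is_deriveB.
by apply: DeriveDef => //; rewrite -derive1E.
Unshelve. all: by end_near. Qed.

(** The clamping map is continuous with values in [[p, q]], so continuity of [g] relative to that
    segment suffices. This extends [g] to the whole line by its end values. *)
Lemma continuous_clamp g (p q : R) : p <= q ->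
  {within `[p, q], continuous g} ->
  continuous (fun z => g (Num.max p (Num.min z q))).
Proof.
move=> pq /subspace_continuousP cg z.
pose k : R -> R := fun z => Num.max p (Num.min z q).
have kpq y : `[p, q]%classic (k y).
  by rewrite /= in_itv/= le_max lexx/= ge_max pq ge_min lexx orbT.
have ck : {for z, continuous k}.
  apply: (@continuous_max R R (cst p) (fun z => Num.min z q)).
    exact: cst_continuous.
  apply: (@continuous_min R R id (cst q)); first exact: cvg_id.
  exact: cst_continuous.
apply: (cvg_comp _ _ _ (cg _ (kpq z))).
move=> U /= kU; have := ck _ kU; apply: (@filterS _ (nbhs z)) => y /= Uy; exact/Uy/kpq.
Qed.

(* [t] may be an end point of [J], hence only a neighbourhood relative to [J]. *)
Lemma interval_segment_nbhs J (t0 t : R) : is_interval J -> J t0 -> J t ->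
  exists p q, [/\ p <= q, `[p, q] `<=` J, p <= t0 <= q, p <= t <= q
    & within J (nbhs t) `[p, q]%classic].
Proof.
move=> iJ Jt0 Jt.
(* Any point of [J] below [t] can serve as [p]; if there is none, [t] is the least point of [J] and
   [p = t] works. The choice of [q] is symmetric. *)
have [p [Jp pt pN]] : exists p, [/\ J p, p <= t &
    within J (nbhs t) [set z | p <= z]].
  have [[p [Jp pt]]|np] := pselect (exists p, J p /\ p < t).
    exists p; split => //; first exact: ltW.
    by apply: filterS (lt_nbhsr pt) => z /ltW pz _.
  exists t; split => //; apply: (@filterE _ (nbhs t)) => z Jz /=.
  by rewrite leNgt; apply/negP => zt; apply: np; exists z.
have [q [Jq tq qN]] : exists q, [/\ J q, t <= q &
    within J (nbhs t) [set z | z <= q]].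
  have [[q [Jq tq]]|nq] := pselect (exists q, J q /\ t < q).
    exists q; split => //; first exact: ltW.
    by apply: filterS (lt_nbhsl tq) => z /ltW zq _.
  exists t; split => //; apply: (@filterE _ (nbhs t)) => z Jz /=.
  by rewrite leNgt; apply/negP => zt; apply: nq; exists z.
(* The minimum and the maximum enlarge the segment so that it also contains [t0]. *)
exists (Num.min p t0), (Num.max q t0); split.
- by rewrite ge_min !le_max lexx !orbT.
- move=> z/=; rewrite in_itv/=; apply: iJ.
  + by rewrite minElt; case: ifP.
  + by rewrite maxElt; case: ifP.
- by rewrite ge_min le_max lexx !orbT.
- by rewrite ge_min le_max pt tq.
- apply: filterS2 pN qN => z /= pz zq.
  by rewrite in_itv/= ge_min le_max pz zq.
Qed.

Section oint_within.
Variables (J : set R) (g : R -> R) (t0 : R).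
Hypotheses (iJ : is_interval J) (Jt0 : J t0).
Hypothesis cg : {within J, continuous g}.

(** [is_derive_oint] wants continuity on the whole line, which [g] has only on [J]. Clamping to a
    segment containing [t0] and [t] changes no integral from [t0] to a point of [J] near [t]. *)
Let oint_clamp (t : R) : J t -> exists h, [/\ continuous h, h t = g t &
  \forall s \near within J (nbhs t), oint t0 s h = oint t0 s g].
Proof.
move=> Jt; have [p [q [pq pqJ t0pq tpq npq]]] := interval_segment_nbhs iJ Jt0 Jt.
pose h z := g (Num.max p (Num.min z q)).
have hg z : p <= z <= q -> h z = g z.
  by rewrite /h => /andP[pz zq]; rewrite (min_idPl zq) (max_idPr pz).
exists h; split; [|exact: hg|].
  by apply: continuous_clamp => //; apply: continuous_subspaceW cg.
apply: filterS npq => s /=; rewrite in_itv/= => /andP[ps sq].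
case/andP: t0pq => pt0 t0q; apply: eq_oint => z zs; apply: hg.
by case/orP: zs => /andP[az za]; rewrite (le_trans _ az) ?(le_trans za).
Qed.

Lemma within_continuous_oint : {within J, continuous (fun t => oint t0 t g)}.
Proof.
apply/subspace_continuousP => t Jt; have [h [ch _ hg]] := oint_clamp Jt.
have {}ch : oint t0 s h @[s --> t] --> oint t0 t h.
  apply: differentiable_continuous; apply/derivable1_diffP.
  by have [] := is_derive_oint t0 t ch.
have hgt := nbhs_singleton hg Jt.
rewrite /from_subspace -hgt.
apply: cvg_trans (cvg_within_filter J ch); exact: near_eq_cvg.
Qed.

(** At an interior point, neighbourhoods relative to [J] are ordinary ones, so the derivative found
    for the clamped function carries over. *)
Lemma is_derive_oint_within (t : R) : interior J t ->
  is_derive t 1 (fun s => oint t0 s g) (g t).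
Proof.
move=> Jt; have [h [ch <- hg]] := oint_clamp (interior_subset Jt).
rewrite within_interior// in hg.
by apply: (near_eq_is_derive hg); exact: is_derive_oint.
Qed.
End oint_within.

End oint.

(** * Continuously differentiable functions on an open set and their algebra *)

Section C1.
Context {R : realType} {V : normedModType R}.
Implicit Types (F H : V -> R) (G : set V).

(** All directions are taken at once, with continuity in full neighbourhoods; for open [G] this
    yields [continuously_differentiable]. *)
Definition C1 G F := forall p, G p ->
  differentiable F p /\ forall v, {for p, continuous (fun q => 'D_v F q)}.

(** Openness makes equality on [G] local at each point, so the derivatives agree, and they do so
    throughout a neighbourhood of [p]. *)
Lemma eq_C1 G F H : open G -> (forall p, G p -> F p = H p) -> C1 G F -> C1 G H.
Proof.
move=> oG FH cF p Gp; have [dF cDF] := cF p Gp.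
have FHn q : G q -> \forall z \near q, F z = H z.
  by move=> Gq; apply: filterS (open_nbhs_nbhs (conj oG Gq)) => z; exact: FH.
split; first exact: near_eq_differentiable (FHn p Gp) dF.
move=> v; rewrite /prop_for/continuous_at -(near_eq_derive v (FHn p Gp)).
apply: cvg_trans (cDF v); apply: near_eq_cvg.
apply: filterS (open_nbhs_nbhs (conj oG Gp)) => q Gq.
by apply: near_eq_derive; exact: FHn.
Qed.

(** The rule for ['D_v] is available at points of [G]; since these fill a neighbourhood of [p], the
    limit transfers. Sums and products follow the same pattern. *)
Lemma C1B G F H : open G -> C1 G F -> C1 G H -> C1 G (F \- H).
Proof.
move=> oG cF cH p Gp; have [dF cDF] := cF p Gp; have [dH cDH] := cH p Gp.
split; first exact: differentiableB.
move=> v; have E q : G q -> 'D_v F q - 'D_v H q = 'D_v (F \- H) q.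
  move=> Gq; rewrite deriveB//; apply: diff_derivable.
    by have [] := cF q Gq.
  by have [] := cH q Gq.
rewrite /prop_for/continuous_at -E//.
apply: cvg_trans (cvgB (cDF v) (cDH v)); apply: near_eq_cvg.
by apply: filterS (open_nbhs_nbhs (conj oG Gp)) => q; exact: E.
Qed.

Lemma C1D G F H : open G -> C1 G F -> C1 G H -> C1 G (F \+ H).
Proof.
move=> oG cF cH p Gp; have [dF cDF] := cF p Gp; have [dH cDH] := cH p Gp.
split; first exact: differentiableD.
move=> v; have E q : G q -> 'D_v F q + 'D_v H q = 'D_v (F \+ H) q.
  move=> Gq; rewrite deriveD//; apply: diff_derivable.
    by have [] := cF q Gq.
  by have [] := cH q Gq.
rewrite /prop_for/continuous_at -E//.
apply: cvg_trans (cvgD (cDF v) (cDH v)); apply: near_eq_cvg.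
by apply: filterS (open_nbhs_nbhs (conj oG Gp)) => q; exact: E.
Qed.

Lemma C1M G F H : open G -> C1 G F -> C1 G H -> C1 G (F \* H).
Proof.
move=> oG cF cH p Gp; have [dF cDF] := cF p Gp; have [dH cDH] := cH p Gp.
split; first exact: differentiableM.
move=> v.
have E q : G q -> F q * 'D_v H q + H q * 'D_v F q = 'D_v (F \* H) q.
  move=> Gq; rewrite deriveM//; apply: diff_derivable.
    by have [] := cF q Gq.
  by have [] := cH q Gq.
rewrite /prop_for/continuous_at -E//.
apply: (cvg_trans _ (cvgD (cvgM (differentiable_continuous dF) (cDH v))
                          (cvgM (differentiable_continuous dH) (cDF v)))).
apply: near_eq_cvg.
by apply: filterS (open_nbhs_nbhs (conj oG Gp)) => q; exact: E.
Qed.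

Lemma C1_cst G (c : R) : C1 G (cst c).
Proof.
move=> p Gp; split=> [|v]; first exact: differentiable_cst.
rewrite (_ : (fun q => 'D_v (cst c) q) = cst 0); first exact: cst_continuous.
by apply/funext => q; rewrite derive_cst.
Qed.

Lemma C1_bigsum G (I : eqType) (r : seq I) (F : I -> V -> R) : open G ->
  (forall i, i \in r -> C1 G (F i)) -> C1 G (fun p => \sum_(i <- r) F i p).
Proof.
move=> oG; elim: r => [_|i r IH cF].
  by under eq_fun do rewrite big_nil; exact: C1_cst.
under eq_fun do rewrite big_cons.
apply: (@C1D _ (F i) (fun p => \sum_(j <- r) F j p)) => //.
  exact/cF/mem_head.
by apply: IH => j jr; apply: cF; rewrite in_cons jr orbT.
Qed.

End C1.

(** * Functions of time alone, viewed on the product space *)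

Section time_dependent.
Context {R : realType} {W : normedModType R}.

(** Continuity is kept on all of [J], end points included, because the recursions integrate such
    functions again from [t0], which may be an end point. *)
Definition primitive (J : set R) (u v : R -> R) := [/\ {within J, continuous u},
  {within J, continuous v} & forall t, interior J t -> is_derive t 1 u (v t)].

Lemma primitive_oint (J : set R) (t0 : R) (u g : R -> R) :
  is_interval J -> J t0 -> {within J, continuous g} ->
  (forall t, J t -> u t = oint t0 t g) -> primitive J u g.
Proof.
move=> iJ Jt0 cg ug; split => //.
  apply: subspace_eq_continuous (within_continuous_oint iJ Jt0 cg) => t.
  by rewrite inE => /ug.
move=> t Jt; apply: near_eq_is_derive (is_derive_oint_within iJ Jt0 cg Jt).
by apply: filterS Jt => s /ug.
Qed.

Lemma primitive_cst (J : set R) (u : R -> R) (c : R) :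
  (forall t, J t -> u t = c) -> primitive J u (cst 0).
Proof.
move=> uc; split.
- apply: (@subspace_eq_continuous _ _ _ (cst c)); last exact: cst_continuous.
  by move=> t; rewrite inE => /uc.
- exact: cst_continuous.
- move=> t Jt; apply: near_eq_is_derive (is_derive_cst c t 1).
  by apply: filterS Jt => s /uc.
Qed.

(** A box around [p] inside [G] projects to a neighbourhood of [p.1] inside [J]. *)
Lemma open_fst_interior (G : set (R * W)) (J : set R) (p : R * W) :
  open G -> G `<=` J `*` setT -> G p -> interior J p.1.
Proof.
move=> oG GJ Gp; have [[A B] /= [Ap Bp] AB] := open_nbhs_nbhs (conj oG Gp).
apply: filterS Ap => t At.
have [] // := GJ (t, p.2).
by apply: AB; split => //=; exact: nbhs_singleton Bp.
Qed.

Lemma is_derive_fst (u : R -> R) (p w : R * W) (du : R) :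
  is_derive p.1 1 u du -> is_derive p w (u \o fst) (w.1 * du).
Proof.
move=> [/derivable1_diffP du1 <-].
have dfst : differentiable fst p.
  by apply: (@linear_differentiable _ _ _ fst) => q; exact: cvg_fst.
have dc : differentiable (u \o fst) p by exact: differentiable_comp.
apply: DeriveDef; first exact: diff_derivable.
rewrite deriveE// diff_comp//= diff_lin//; last by move=> q; exact: cvg_fst.
by rewrite -derive1E diff1E.
Qed.

(** The derivative along [w] is [w.1 * v q.1]; times of points of [G] are interior to [J], where
    relative continuity of [v] is ordinary continuity. *)
Lemma C1_fst (J : set R) (G : set (R * W)) (u v : R -> R) :
  open G -> G `<=` J `*` setT -> primitive J u v -> C1 G (u \o fst).
Proof.
move=> oG GJ [_ cv uv] p Gp; have ip := open_fst_interior oG GJ Gp.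
split.
  apply: differentiable_comp.
    by apply: (@linear_differentiable _ _ _ fst) => q; exact: cvg_fst.
  by apply/derivable1_diffP; have [] := uv _ ip.
move=> w.
have E q : G q -> w.1 * v q.1 = 'D_w (u \o fst) q.
  move=> Gq; have /uv := open_fst_interior oG GJ Gq.
  by move=> /(is_derive_fst w)[_ ->].
rewrite /prop_for/continuous_at -E//.
have /subspace_continuousP/(_ _ (interior_subset ip)) := cv.
rewrite within_interior// => cvp.
have cvf : v q.1 @[q --> p] --> v p.1 by apply: cvg_comp cvp; exact: cvg_fst.
apply: (cvg_trans _ (cvgM (cvg_cst w.1) cvf)); apply: near_eq_cvg.
by apply: filterS (open_nbhs_nbhs (conj oG Gp)) => q; exact: E.
Qed.
End time_dependent.

(** * Products and sums: continuity, and a change of order over a triangle of indices *)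

Section continuity.
Context {R : realType} {T : topologicalType}.
Implicit Types f g : T -> R.

Lemma continuous_mul f g : continuous f -> continuous g ->
  continuous (fun z => f z * g z).
Proof. by move=> cf cg z; apply: cvgM; [exact: cf|exact: cg]. Qed.

Lemma continuous_add f g : continuous f -> continuous g ->
  continuous (fun z => f z + g z).
Proof. by move=> cf cg z; apply: cvgD; [exact: cf|exact: cg]. Qed.

Lemma continuous_bigsum (I : eqType) (r : seq I) (f : I -> T -> R) :
  (forall i, i \in r -> continuous (f i)) ->
  continuous (fun z => \sum_(i <- r) f i z).
Proof.
elim: r => [_|i r IH cf].
  by under eq_fun do rewrite big_nil; exact: cst_continuous.
under eq_fun do rewrite big_cons.
apply: continuous_add; first exact/cf/mem_head.
by apply: IH => j jr; apply: cf; rewrite in_cons jr orbT.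
Qed.

End continuity.

(** Both sides run over the positive [k], [xi] with [k + xi <= tau], a condition symmetric in the
    two. *)
Lemma exchange_triangle (R : nmodType) (tau : nat) (g : nat -> nat -> R) :
  \sum_(1 <= k < tau) \sum_(1 <= xi < (tau - k).+1) g k xi =
  \sum_(1 <= xi < tau) \sum_(1 <= k < (tau - xi).+1) g k xi.
Proof.
have E (h : nat -> nat -> R) :
    \sum_(1 <= k < tau) \sum_(1 <= xi < (tau - k).+1) h k xi =
    \sum_(1 <= k < tau) \sum_(1 <= xi < tau | (k + xi <= tau)%N) h k xi.
  apply: eq_big_nat => k /andP[k1 kt].
  rewrite (big_nat_widen _ _ tau); last by lia.
  by rewrite big_nat_cond [RHS]big_nat_cond; apply: eq_bigl => xi; lia.
rewrite E (E (fun xi k => g k xi)) (exchange_big_dep_nat xpredT)//.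
by apply: eq_bigr => xi _; apply: eq_bigl => k; rewrite addnC.
Qed.

(** * Coordinate functions, and the equation of a first integral as one directional derivative *)

Section coordinates.
Context {R : realType} {n : nat}.
Implicit Types (p w : R * 'rV[R]_n).

Lemma xcE (x : 'rV[R]_n) (i : 'I_n) : xc x i.+1 = x 0 i.
Proof. by rewrite /xc /= valK. Qed.

Lemma xc_triangular_field (a : nat -> nat -> R -> R) (f : nat -> R -> R)
    (t : R) (x : 'rV[R]_n) (m : nat) : (0 < m)%N -> (m <= n)%N ->
  xc (triangular_field a f t x) m = \sum_(m <= j < n.+1) a m j t * xc x j + f m t.
Proof.
case: m => // m _ mn; rewrite -[m.+1]/((Ordinal mn : nat).+1).
by rewrite xcE mxE.
Qed.

(** For these [j] the function is a continuous linear map, hence its own differential at every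
    point. *)
Lemma differentiable_xc p (j : nat) : (0 < j <= n)%N ->
  differentiable (fun q => xc q.2 j) p /\
  forall w, 'D_w (fun q => xc q.2 j) p = xc w.2 j.
Proof.
case: j => // j jn.
pose i := Ordinal jn.
pose c (x : 'rV[R]_n) := x 0 i.
have lc : linear c by move=> k x y; rewrite /c !mxE.
pose cl : {linear 'rV[R]_n -> R} := HB.pack c (GRing.isLinear.Build _ _ _ _ c lc).
have cc : continuous cl by move=> x; exact: coord_continuous.
have csnd : continuous (@snd R 'rV[R]_n) by move=> q; exact: cvg_snd.
have -> : (fun q : R * 'rV[R]_n => xc q.2 j.+1) = cl \o snd.
  by apply/funext => q; rewrite -[j.+1]/((i : nat).+1) xcE.
have dsnd : differentiable (@snd R 'rV[R]_n) p by exact: linear_differentiable.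
have dcl x : differentiable cl x by exact: linear_differentiable.
split; first exact: differentiable_comp.
move=> w; rewrite deriveE; last exact: differentiable_comp.
by rewrite diff_comp// !diff_lin//= -[j.+1]/((i : nat).+1) xcE.
Qed.

Lemma C1_xc (G : set (R * 'rV[R]_n)) (j : nat) : (0 < j <= n)%N ->
  C1 G (fun q => xc q.2 j).
Proof.
move=> jn p _; have [dx Dx] := differentiable_xc p jn; split=> // w.
rewrite (_ : (fun q => _) = cst (xc w.2 j)); first exact: cst_continuous.
by apply/funext => q; have [_ ->] := differentiable_xc q jn.
Qed.

(** The differential is linear in the direction, so the sum over coordinates is the single
    derivative along [(1, X t x)], with the vector frozen at the point considered. *)
Lemma first_integral_of_C1 (X : R -> 'rV[R]_n -> 'rV[R]_n)
    (G : set (R * 'rV[R]_n)) (F : R * 'rV[R]_n -> R) : domain (R := R) G -> C1 G F ->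
  (forall t x, G (t, x) -> 'D_(1, X t x) F (t, x) = 0) -> first_integral X G F.
Proof.
move=> dG cF DF0; split => //.
  split=> [p /cF[]//| |i]; rewrite continuous_open_subspace; try exact: dG.1;
    by move=> p; rewrite inE => /cF[_ cDF]; exact: cDF.
move=> t x Gtx; have [dF _] := cF _ Gtx; rewrite -[RHS](DF0 t x Gtx).
have -> : (1, X t x) = dt n + \sum_(i < n) X t x 0 i *: dx i :> R * 'rV[R]_n.
  apply: injective_projections => /=.
    rewrite raddf_sum/= big1 ?addr0// => i _; exact: scaler0.
  rewrite raddf_sum/= add0r; exact: row_sum_delta.
rewrite !deriveE// linearD linear_sum; congr (_ + _); apply: eq_bigr => i _.
by rewrite deriveE// linearZ.
Qed.

End coordinates.

(** The algebra of the substitution: with [m = n + 1 - tau], [al k] stands for the coefficient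
    [a m (m + k)], [ps k] for [psi] and [y k] for the coordinate at [m + k]. Up to the factor [phi],
    the right-hand side displays the integrand of each [A tau xi] and the sum in that of [B tau]. *)
Lemma triangular_substitution (R : comPzRingType) (tau : nat)
    (al ps y Fv Bv : nat -> R) (A : nat -> nat -> R) :
  (forall k, (0 < k < tau)%N -> y k = ps k *
     (\sum_(1 <= xi < (tau - k).+1) A (tau - k)%N xi * Fv xi + Bv (tau - k)%N)) ->
  \sum_(1 <= k < tau) al k * y k =
  \sum_(1 <= xi < tau)
     Fv xi * (\sum_(1 <= k < (tau - xi).+1) al k * ps k * A (tau - k)%N xi)
  + \sum_(1 <= k < tau) al k * ps k * Bv (tau - k)%N.
Proof.
move=> hy; under [X in _ = X + _]eq_bigr do rewrite mulr_sumr.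
rewrite -(exchange_triangle tau (fun k xi => Fv xi * (al k * ps k * A (tau - k)%N xi))).
rewrite -big_split/=; apply: eq_big_nat => k hk.
rewrite hy// mulrA mulrDr mulr_sumr; congr (_ + _).
by apply: eq_bigr => xi _; ring.
Qed.

(** * Regularity of the recursive coefficients and vanishing of the derivative along the system *)

Theorem theorem2p4 (R : realType) (n : nat) (J : set R) (hJ : is_interval J)
  (a : nat -> nat -> R -> R) (f : nat -> R -> R)
  (ha : forall i j : nat, (1 <= i)%N -> (i <= j)%N -> (j <= n)%N ->
    {within J, continuous (a i j)})
  (hf : forall i : nat, (1 <= i)%N -> (i <= n)%N -> {within J, continuous (f i)})
  (t0 : R) (ht0 : J t0)
  (A : nat -> nat -> R -> R) (B : nat -> R -> R)
  (F : nat -> R * 'rV[R]_n -> R)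
  (hA1 : forall (zeta : nat) (t : R), (1 <= zeta)%N -> (zeta <= n - 1)%N -> J t ->
    A zeta zeta t = 1)
  (hA : forall (tau xi : nat) (t : R),
    (1 <= tau)%N -> (tau <= n)%N -> (1 <= xi)%N -> (xi <= tau - 1)%N -> J t ->
    A tau xi t =
      oint t0 t (fun z =>
        (\sum_(1 <= k < (tau - xi).+1)
           a (n + 1 - tau)%N (n + 1 + k - tau)%N z
           * psi a t0 (n + 1 + k - tau)%N z * A (tau - k)%N xi z)
        * phi a t0 (n + 1 - tau)%N z))
  (hB : forall (tau : nat) (t : R), (1 <= tau)%N -> (tau <= n)%N -> J t ->
    B tau t =
      oint t0 t (fun z =>
        (f (n + 1 - tau)%N z
         + \sum_(1 <= xi < tau)
             a (n + 1 - tau)%N (n + 1 - tau + xi)%N z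
             * psi a t0 (n + 1 - tau + xi)%N z * B (tau - xi)%N z)
        * phi a t0 (n + 1 - tau)%N z))
  (hF : forall (tau : nat) (t : R) (x : 'rV[R]_n),
    (1 <= tau)%N -> (tau <= n)%N -> J t ->
    F tau (t, x) =
      xc x (n + 1 - tau)%N * phi a t0 (n + 1 - tau)%N t
      - (\sum_(1 <= xi < tau) A tau xi t * F xi (t, x)) - B tau t) :
  forall (G : set (R * 'rV[R]_n)),
    domain (R := R) G -> G `<=` J `*` setT ->
    forall tau : nat, (1 <= tau)%N -> (tau <= n)%N ->
      first_integral (triangular_field (n := n) a f) G (F tau).
Proof.
move=> G dG GJ.
have oG : open G := dG.1.
have GJ1 p : G p -> J p.1 by move=> /GJ[].
have coint s : (1 <= s)%N -> (s <= n)%N ->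
    {within J, continuous (fun t => oint t0 t (a s s))}.
  by move=> s1 sn; apply: within_continuous_oint => //; exact: ha.
have cpsi s : (1 <= s)%N -> (s <= n)%N -> {within J, continuous (psi a t0 s)}.
  move=> s1 sn t; apply: continuous_comp; first exact: coint.
  exact: continuous_expR.
have cphi s : (1 <= s)%N -> (s <= n)%N -> {within J, continuous (phi a t0 s)}.
  move=> s1 sn t; apply: continuous_comp; last exact: continuous_expR.
  by apply: cvgN; exact: coint.
have pphi s : (1 <= s)%N -> (s <= n)%N ->
    primitive J (phi a t0 s) (fun t => phi a t0 s t * - a s s t).
  move=> s1 sn; split; first exact: cphi.
    apply: continuous_mul; first exact: cphi.
    by move=> t; apply: cvgN; exact: ha.
  move=> t Jt.
  have Do := is_derive_oint_within hJ ht0 (ha s s s1 (leqnn s) sn) Jt.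
  have DN := is_deriveN Do.
  exact: (is_derive1_comp (is_derive_expR _) DN).
pose dA tau xi z := (\sum_(1 <= k < (tau - xi).+1)
           a (n + 1 - tau)%N (n + 1 + k - tau)%N z
           * psi a t0 (n + 1 + k - tau)%N z * A (tau - k)%N xi z)
        * phi a t0 (n + 1 - tau)%N z.
pose dB tau z := (f (n + 1 - tau)%N z
         + \sum_(1 <= xi < tau)
             a (n + 1 - tau)%N (n + 1 - tau + xi)%N z
             * psi a t0 (n + 1 - tau + xi)%N z * B (tau - xi)%N z)
        * phi a t0 (n + 1 - tau)%N z.
have pA tau xi : (1 <= xi)%N -> (xi < tau)%N -> (tau <= n)%N ->
    primitive J (A tau xi) (dA tau xi).
  move=> xi1; elim/ltn_ind: tau => tau IH xit taun.
  apply: (@primitive_oint _ J t0) => // [|t Jt]; last by apply: hA => //; lia.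
  apply: continuous_mul; last by apply: cphi; lia.
  apply: continuous_bigsum => k; rewrite mem_index_iota => /andP[k1 kt].
  apply: continuous_mul; first apply: continuous_mul.
  - by apply: ha; lia.
  - by apply: cpsi; lia.
  (* The last index [k = tau - xi] meets the diagonal coefficient, which is prescribed to be 1
     instead of given by an integral; here [xi < tau <= n] keeps [xi] within the range of [hA1]. *)
  - have [tk|tk] := eqVneq (tau - k)%N xi.
      have [] // := @primitive_cst R J (A (tau - k)%N xi) 1.
      by move=> t Jt; rewrite tk; apply: hA1 => //; lia.
    by have [] // := IH (tau - k)%N; lia.
have pB tau : (1 <= tau)%N -> (tau <= n)%N -> primitive J (B tau) (dB tau).
  elim/ltn_ind: tau => tau IH tau1 taun.
  apply: (@primitive_oint _ J t0) => // [|t Jt]; last exact: hB.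
  apply: continuous_mul; last by apply: cphi; lia.
  apply: continuous_add; first by apply: hf; lia.
  apply: continuous_bigsum => k; rewrite mem_index_iota => /andP[k1 kt].
  apply: continuous_mul; first apply: continuous_mul.
  - by apply: ha; lia.
  - by apply: cpsi; lia.
  - by have [] // := IH (tau - k)%N; lia.
(* The recursion for [F tau] is known only for times in [J]; [F'] is its right-hand side on the
   whole product, equal to [F] on [G]. *)
pose F' tau (p : R * 'rV[R]_n) :=
  xc p.2 (n + 1 - tau) * (phi a t0 (n + 1 - tau) \o fst) p
  - (\sum_(1 <= xi < tau) (A tau xi \o fst) p * F xi p) - (B tau \o fst) p.
have FE tau p : (1 <= tau)%N -> (tau <= n)%N -> G p -> F' tau p = F tau p.
  by case: p => t x tau1 taun /GJ1 Jt; rewrite hF.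
have C1F tau : (1 <= tau)%N -> (tau <= n)%N -> C1 G (F tau).
  elim/ltn_ind: tau => tau IH tau1 taun.
  apply: (eq_C1 oG (fun p => FE tau p tau1 taun)).
  apply: C1B => //; last exact: C1_fst (pB _ tau1 taun).
  apply: (@C1B _ _ _ (fun p => _ * _) (fun p => \sum_(_ <- _) _)) => //.
    apply: (@C1M _ _ _ (fun p => xc p.2 _)) => //; first by apply: C1_xc; lia.
    by apply: C1_fst (pphi _ _ _) => //; lia.
  apply: C1_bigsum => // xi; rewrite mem_index_iota => /andP[xi1 xit].
  apply: C1M => //; first exact: C1_fst (pA _ _ _ _ _).
  by apply: IH => //; lia.
(* The summand [xi = s] is [F s] itself, since [A s s] is 1; this is where [s < n] enters. Then
   [psi] is the inverse of [phi]. *)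
have xcF s t x : (1 <= s)%N -> (s < n)%N -> J t ->
    xc x (n + 1 - s) = psi a t0 (n + 1 - s) t *
      (\sum_(1 <= xi < s.+1) A s xi t * F xi (t, x) + B s t).
  move=> s1 sn Jt; rewrite big_nat_recr//= hA1 ?mul1r//; last by lia.
  rewrite hF//; last exact: ltnW.
  rewrite /phi /psi expRN.
  have := expR_gt0 (oint t0 t (a (n + 1 - s)%N (n + 1 - s)%N)).
  by move=> /lt0r_neq0 ?; field.
have DF tau : (1 <= tau)%N -> (tau <= n)%N -> forall t x, G (t, x) ->
    is_derive (t, x) (1, triangular_field a f t x) (F tau) 0.
  elim/ltn_ind: tau => tau IH tau1 taun t x Gtx.
  have Jt := GJ1 _ Gtx.
  have It := open_fst_interior oG GJ Gtx.
  set w := (1, _).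
  have FEn : \forall p \near (t, x), F' tau p = F tau p.
    by apply: filterS (open_nbhs_nbhs (conj oG Gtx)) => p; exact: FE.
  apply: (near_eq_is_derive FEn).
  pose m := (n + 1 - tau)%N.
  have /andP[m1 mn] : (0 < m <= n)%N by rewrite /m; lia.
  have Dx : is_derive (t, x) w (fun p => xc p.2 m)
      (\sum_(m <= j < n.+1) a m j t * xc x j + f m t).
    have [dx Dx] := differentiable_xc (t, x) (introT andP (conj m1 mn)).
    apply: DeriveDef; first exact: diff_derivable.
    by rewrite Dx xc_triangular_field.
  have Dfst u v : primitive J u v -> is_derive (t, x) w (u \o fst) (v t).
    move=> [_ _ /(_ t It) Du]; rewrite -[v t]mul1r.
    exact: (@is_derive_fst _ _ u (t, x) w _ Du).
  have Dphi := Dfst _ _ (pphi m m1 mn).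
  (* By induction [F xi] has derivative 0 along [w], so the product rule leaves only the terms with
     [dA]. *)
  have DA : is_derive (t, x) w (fun p => \sum_(1 <= xi < tau)
      (A tau xi \o fst) p * F xi p)
      (\sum_(1 <= xi < tau) F xi (t, x) * dA tau xi t).
    apply: is_derive_bigsum => xi; rewrite mem_index_iota => /andP[xi1 xit].
    have DAxi := Dfst _ _ (pA _ _ xi1 xit taun).
    have DFxi := IH xi xit xi1 (ltnW (leq_trans xit taun)) t x Gtx.
    apply: is_derive_eq (is_deriveM DAxi DFxi) _.
    by rewrite scaler0 add0r.
  have DB := Dfst _ _ (pB _ tau1 taun).
  apply: is_derive_eq (is_deriveB (is_deriveB (is_deriveM Dx Dphi) DA) DB) _.
  have mk k : (k < tau)%N -> (n + 1 + k - tau = m + k)%N by rewrite /m; lia.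
  (* The diagonal term is split off and the rest reindexed by [j = m + k]; the bound [k < tau] comes
     from [n + 1 - m = tau]. *)
  have SE : \sum_(m <= j < n.+1) a m j t * xc x j =
      a m m t * xc x m + \sum_(1 <= k < tau) a m (m + k)%N t * xc x (m + k).
    rewrite big_ltn; last by lia.
    rewrite -{1}[m.+1]add1n big_addn (_ : n.+1 - m = tau)%N; last by lia.
    by congr (_ + _); apply: eq_bigr => k _; rewrite addnC.
  rewrite SE (@triangular_substitution _ tau (fun k => a m (m + k)%N t)
    (fun k => psi a t0 (m + k) t) (fun k => xc x (m + k)) (fun xi => F xi (t, x))
    (fun s => B s t) (fun s xi => A s xi t)); last first.
    (* The coordinate [m + k] is the one that [xcF] recovers at [s = tau - k], and [k >= 1] ensures
       [s < n]. *)
    move=> k /andP[k1 kt] /=; rewrite (_ : m + k = n + 1 - (tau - k))%N; last by lia.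
    by rewrite (xcF _ t)//; lia.
  have AE : \sum_(1 <= xi < tau) F xi (t, x) * dA tau xi t =
      phi a t0 m t * \sum_(1 <= xi < tau) F xi (t, x) *
        \sum_(1 <= k < (tau - xi).+1)
           a m (m + k)%N t * psi a t0 (m + k) t * A (tau - k)%N xi t.
    rewrite mulr_sumr; apply: eq_big_nat => xi /andP[xi1 xit].
    rewrite /dA -/m mulrCA mulrC -mulrA mulrCA; congr (_ * (_ * _)).
    by apply: eq_big_nat => k /andP[k1 kt]; rewrite mk//; lia.
  (* With [phi a t0 m t] factored out of every sum, the diagonal terms, the [F xi] terms and the [B]
     terms cancel separately. *)
  rewrite [X in _ - X - _]AE /dB -/m /= /GRing.scale/=; ring.
by move=> tau tau1 taun; apply: first_integral_of_C1 => [//||t x Gtx];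
  [exact: C1F|have [] := DF tau tau1 taun t x Gtx].
Qed.
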